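(* Let $X$ be a finite CW complex with oriented cells, $d\ge 1$, $b_d=\dim B_d(X;\mathbb Q)$, and let $V_1\subset S_{d+1}$ be a $(d+1)$-dimensional spanning forest of $X$. Let $M=(\langle\partial_{d+1}u,\partial_{d+1}v\rangle)_{u,v\in V_1}$ be the boundary mesh matrix of the geometric basis $\{\partial_{d+1}u\mid u\in V_1\}$ of $B_d(X;\mathbb Q)$. Then $M$ is a $b_d\times b_d$ matrix, and the coefficient of $(-1)^kt^{b_d-k}$ in its characteristic polynomial $\det(t\,\mathrm{Id}-M)$ is the $k$-th elementary symmetric function of its eigenvalues, called $\sigma_k(V_1)$. Moreover, there is a direct combinatorial formula for this coefficient: $$\sigma_k(V_1)=\sum_{U\subset V_1,\ |U|=k}\ \left(\ \sum_{W\ \text{a } d\text{-dimensional spanning coforest in } X^{(d)}\cup V_1\cup U}\big|H_{d-1}(X_{V_1},X_{W^c};\mathbb Z)\big|^2\right),$$ where $|H_{d-1}(X_{V_1},X_{W^c};\mathbb Z)|$ is the order of the finite torsion group $H_{d-1}(X_{V_1},X_{W^c};\mathbb Z)$, with $X_{V_1}=X^{(d)}\cup V_1$ and $X_{W^c}=X^{(d-1)}\cup(S_d\setminus W)$. This weight $|H_{d-1}(X_{V_1},X_{W^c};\mathbb Z)|$ is alternately expressed as the integer $$\frac{t_{d-1}(X_W)\;t_{d-2}(X_{(V_1)^c})\;t'_{d-1}(V_1)}{t_{d-2}(X)} .$$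
   Context: $C_i$, $Z_i$, $B_i$ are cellular chains, cycles, boundaries; $S_i$ is the set of oriented $i$-cells of $X$; $\langle\cdot,\cdot\rangle$ is the bilinear pairing on $C_d(X;\mathbb Q)$ for which the $d$-cells are orthonormal; $X^{(i)}$ is the $i$-skeleton. $t_i(Y)$ is the order of the torsion subgroup of $H_i(Y;\mathbb Z)$. A $(d+1)$-dimensional spanning forest of $X$ is a set $V_1\subset S_{d+1}$ with $|V_1|=b_d$ and $Z_{d+1}(X^{(d)}\cup V_1;\mathbb R)=0$; then $\{\partial_{d+1}u\mid u\in V_1\}$ is a basis of $B_d(X;\mathbb Q)$. A $d$-dimensional spanning coforest in a complex $Y$ is a set $W$ of $d$-cells of $Y$ such that restriction of chains to the cells of $W$, $B_d(Y;\mathbb Q)\subset C_d(Y;\mathbb Q)\to C_d(Y^{(d-1)}\cup W;\mathbb Q)$, is an isomorphism. In the alternative expression, $X_W=X^{(d-1)}\cup W$, $(V_1)^c=S_{d+1}\setminus V_1$, $X_{(V_1)^c}=X^{(d)}\cup(V_1)^c$, and $t'_{d-1}(V_1)$ is the order of the quotient of $Z_{d-1}(X;\mathbb Z)$ by $\big(Z_{d-1}(X;\mathbb Z)\cap B_{d-1}(X;\mathbb Q)\big)+Z_{d-1}(X_{(V_1)^c};\mathbb Z)$.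
   Formalization: Inner sum is over coforests W in X_U=X^{(d)}∪U; the weight is |H_d(X_U,X_{W^c};Z)| = t_d(X_U) t_{d-1}(X_{W^c}) t'/t_{d-1}(X), with t' the order of Z_d(X)/((Z_d(X)∩B_d(X_U;Q))+Z_d(X_{W^c})). As printed, both formulas are false. *)

(* Defs.v *)
From mathcomp Require Import all_boot all_order all_algebra all_field.
From mathcomp Require Import finmap boolp classical_sets functions cardinality reals.
From mathcomp Require mpoly.

Set Implicit Arguments.
Unset Strict Implicit.
Unset Printing Implicit Defensive.

Import Order.TTheory GRing.Theory Num.Theory.
Local Open Scope ring_scope.

(* The cellular data of a finite CW complex with oriented cells: the i-cells
   are indexed by 'I_(ncells i), and row u of [incidence i] lists the incidence
   numbers of the (i+1)-cell u with the i-cells, so that cellular chains are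
   row vectors and the cellular boundary is right multiplication.  All chains,
   cycles, boundaries and homology groups below are the cellular ones, which
   depend on the complex only through these data. *)
Record finCW := FinCW {
  ncells : nat -> nat;
  incidence : forall i, 'M[int]_(ncells i.+1, ncells i);
  incidenceK : forall i, incidence i.+1 *m incidence i = 0;
  finCW_dim : exists N, forall i, (N < i)%N -> ncells i = 0%N }.

Notation cells X i := 'I_(ncells X i).

Section Cells.
Variable X : finCW.

Definition subcx := forall i, {set cells X i}.

Definition whole : subcx := fun i => [set: cells X i]%SET.

(* Y^(i-1) \cup W, for a set W of i-cells.  A cell of dimension j = i is
   compared with those of W through its index, as 'I_(ncells X j) and
   'I_(ncells X i) are different types. *)
Definition attach (Y : subcx) i (W : {set cells X i}) : subcx := fun j =>
  [set x : cells X j | (j < i)%N && (x \in Y j) ||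
     (j == i) && [exists w in W, val w == val x]]%SET.

Section Chains.
Variable R : nzRingType.

(* For i = 0 the boundary is the zero map, as there are no (-1)-cells; its
   codomain is then a dummy, since 0.-1 = 0. *)
Definition boundary i : 'rV[R]_(ncells X i) -> 'rV[R]_(ncells X i.-1) :=
  match i with
  | 0 => fun _ => 0
  | i'.+1 => fun c => c *m map_mx intr (incidence X i')
  end.

Definition chains (Y : subcx) i : set 'rV[R]_(ncells X i) :=
  [set c | forall x, x \notin Y i -> c 0 x = 0]%classic.

Definition cycles (Y : subcx) i : set 'rV[R]_(ncells X i) :=
  [set c | @chains Y i c /\ boundary c = 0]%classic.

Definition bounds (Y : subcx) i : set 'rV[R]_(ncells X i) :=
  (@boundary i.+1 @` @chains Y i.+1)%classic.

Definition restrict i (W : {set cells X i}) (c : 'rV[R]_(ncells X i)) :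
    'rV[R]_(ncells X i) :=
  \row_x (if x \in W then c 0 x else 0).

Definition pairing i (c c' : 'rV[R]_(ncells X i)) : R :=
  \sum_x c 0 x * c' 0 x.

End Chains.
End Cells.

Arguments attach {X} Y {i} W.
Arguments chains {X} R Y i.
Arguments cycles {X} R Y i.
Arguments bounds {X} R Y i.

Section Quotients.
Variable G : zmodType.

(* Meant for subgroups B \subset A of G. *)
Definition cosets (A B : set G) : set (set G) :=
  [set [set y | B (y - x)] | x in A]%classic.

(* The order of A / B; it is 0 when A / B is infinite. *)
Definition quo_order (A B : set G) : nat := #|` fset_set (cosets A B)|%fset.

End Quotients.

Section Homology.
Variable X : finCW.

(* H_i(Y, L; Z) is relcycles Y L i / relbounds Y L i, the kernel of the
   boundary of C(Y)/C(L) modulo its image, both pulled back to C_i(Y). *)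
Definition relcycles (Y L : subcx X) i : set 'rV[int]_(ncells X i) :=
  [set c | chains int Y i c /\ chains int L i.-1 (boundary c)]%classic.

Definition relbounds (Y L : subcx X) i : set 'rV[int]_(ncells X i) :=
  [set b + c | b in bounds int Y i & c in chains int L i]%classic.

Arguments relcycles Y L i : clear implicits.
Arguments relbounds Y L i : clear implicits.

Definition relH_finite (Y L : subcx X) i : Prop :=
  finite_set (cosets (relcycles Y L i) (relbounds Y L i)).

Definition relH_order (Y L : subcx X) i : nat :=
  quo_order (relcycles Y L i) (relbounds Y L i).

Definition torsion_order (Y : subcx X) i : nat :=
  quo_order
    [set c | cycles int Y i c /\
       exists2 m, (0 < m)%N & bounds int Y i (c *+ m)]%classic
    (bounds int Y i).

(* The order of Z_i(X; Z) / ((Z_i(X; Z) \cap B_i(Y; Q)) + Z_i(L; Z)). *)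
Definition tprime_order (Y L : subcx X) i : nat :=
  quo_order (cycles int (whole X) i)
    [set a + b | a in [set c | cycles int (whole X) i c /\
                         bounds rat Y i (map_mx intr c)]
               & b in cycles int L i]%classic.

(* dim B_d(X; Q): B_d(X; Q) is the row space of the matrix of the boundary. *)
Definition bdim d : nat := \rank (map_mx intr (incidence X d) : 'M[rat]_(_, _)).

Definition spanning_forest (R : realType) d (V : {set cells X d.+1}) : Prop :=
  #|V| = bdim d /\ cycles R (attach (whole X) V) d.+1 = [set 0]%classic.

Definition spanning_coforest (Y : subcx X) d (W : {set cells X d}) : Prop :=
  W \subset Y d /\
  set_bij (bounds rat Y d) (chains rat (attach Y W) d) (restrict W).

Definition mesh_matrix d (V : {set cells X d.+1}) : 'M[rat]_#|V| :=
  \matrix_(p, q) pairing (boundary (delta_mx 0 (enum_val p)))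
                         (boundary (delta_mx 0 (enum_val q))).

End Homology.

Arguments bdim X d : clear implicits.

(* The value at lam of the k-th elementary symmetric polynomial. *)
Definition elem_sym (R : comNzRingType) n (k : nat) (lam : n.-tuple R) : R :=
  mpoly.meval (tnth lam) (mpoly.mesym n R k).

(* Main.v *)
(** The chain group in degree [d] is [Z^n], with [L] the lattice spanned by the
    boundaries of the cells of [U] and [P] the chains avoiding [W], so that
    [H_d(X_U, X_{W^c}) = Z^n / (L + P)].  By the Smith normal form its order is
    [|det|] of the [U x W] minor of the boundary matrix, and [W] is a coforest
    exactly when this minor is square and invertible.  The coefficients of the
    characteristic polynomial of the Gram matrix [M] are sums of principal minors,
    which Cauchy-Binet turns into sums of squares of those minors.

    For the weight, let [Z] be the cycles and [S <= Z] the saturation of [L].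
    In the chain [L + P <= S + P <= Z + P <= Z^n] the successive indices are
    [[S : L]], [[Z : S + Z cap P]] and [[im : boundary of P]] with [im] the
    boundaries in degree [d-1]; the last one is the quotient of the torsion
    orders of [X_{W^c}] and [X], as both images have the same saturation. *)

Require Import Defs.
From mathcomp Require Import all_boot all_order all_algebra all_field.
From mathcomp Require Import boolp classical_sets functions cardinality reals.
From mathcomp Require mpoly.
Import Order.TTheory GRing.Theory Num.Theory.
Local Open Scope ring_scope.

Set Implicit Arguments.
Unset Strict Implicit.
Unset Printing Implicit Defensive.

(** * Indices of subgroups *)

Definition subgroup (G : zmodType) (B : set G) : Prop :=
  B 0 /\ forall x y, B x -> B y -> B (x - y).

(** Unlike an equation on [quo_order], this also asserts that the quotient is finite, so that 0
    never stands for an infinite index. *)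
Definition has_index (G : zmodType) (A B : set G) (n : nat) : Prop :=
  (cosets A B #= `I_n)%card.

Section Subgroup.
Variables (G : zmodType) (B : set G).
Hypothesis sB : subgroup B.

Lemma subgroup0 : B 0. Proof. by case: sB. Qed.

Lemma subgroupB x y : B x -> B y -> B (x - y).
Proof. by case: sB => _; apply. Qed.

Lemma subgroupN x : B x -> B (- x).
Proof. by rewrite -sub0r; apply: subgroupB subgroup0. Qed.

Lemma subgroupD x y : B x -> B y -> B (x + y).
Proof. by move=> Bx /subgroupN By; rewrite -[y]opprK; apply: subgroupB. Qed.

Lemma subgroupMn x n : B x -> B (x *+ n).
Proof.
move=> Bx; elim: n => [|n IHn]; first exact: subgroup0.
by rewrite mulrS; apply: subgroupD.
Qed.

Lemma coset_eq x y :
  [set z | B (z - x)]%classic = [set z | B (z - y)]%classic <-> B (x - y).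
Proof.
split=> [eq_xy | Bxy].
  by rewrite -[B _]/([set z | B (z - y)]%classic x) -eq_xy /= subrr; apply: subgroup0.
apply/seteqP; split=> z /= Bz.
  by rewrite -[z](subrK x) -addrA; apply: subgroupD.
by rewrite -[z](subrK y) -addrA -[y - x]opprB; apply: subgroupB.
Qed.

(** Replaces cosets by a numerical code on elements, so that later index computations need not
    handle sets of sets. *)
Lemma has_index_map (A : set G) n : has_index A B n ->
  exists f : G -> nat, [/\ forall x, A x -> (f x < n)%N,
    forall x y, A x -> A y -> (f x = f y <-> B (x - y))
    & forall i, (i < n)%N -> exists2 x, A x & f x = i].
Proof.
case/card_set_bijP=> h [hfun hinj hsur].
have cosA x : A x -> cosets A B [set z | B (z - x)]%classic by exists x.
exists (fun x => h [set z | B (z - x)]%classic); split=> [x Ax | x y Ax Ay | i lt_in].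
- exact: hfun (cosA x Ax).
- rewrite -coset_eq; split=> [|-> //].
  by apply: hinj; apply/mem_set/cosA.
- by have [_ [x Ax <-] <-] := hsur i lt_in; exists x.
Qed.

(** A chosen preimage of each value of [f] represents a coset, and every coset arises exactly once
    in this way. *)
Lemma map_has_index (A : set G) (T : finType) (f : G -> T) :
    (forall x y, A x -> A y -> (f x = f y <-> B (x - y))) ->
    (forall t, exists2 x, A x & f x = t) ->
  has_index A B #|T|.
Proof.
move=> fB fsur; have rep t : exists x, A x /\ f x = t.
  by have [x Ax <-] := fsur t; exists x.
have [r rP] := choice rep.
pose g (t : T) := [set z | B (z - r t)]%classic.
have ginj : {in [set: T] &, injective g}%classic.
  move=> t u _ _ /coset_eq; have [At {2}<-] := rP t; have [Au {2}<-] := rP u.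
  by move=> Btu; apply/fB.
have -> : has_index A B #|T| = (g @` [set: T] #= `I_#|T|)%card :> Prop.
  rewrite /has_index; congr (is_true (_ #= _)%card); apply/seteqP; split.
    move=> _ [x Ax <-]; exists (f x) => //; apply/coset_eq.
    by have [Ar fr] := rP (f x); apply/fB.
  by move=> _ [t _ <-]; exists (r t) => //; case: (rP t).
apply: (card_eq_trans (inj_card_eq ginj)).
apply/card_set_bijP; exists (fun t => val (enum_rank t)); split.
- by move=> t _; apply: ltn_ord.
- by move=> t u _ _ /val_inj/enum_rank_inj.
- by move=> i lt_i; exists (enum_val (Ordinal lt_i)) => //; rewrite enum_valK.
Qed.

Lemma nat_map_has_index (A : set G) n (f : G -> nat) :
    (forall x, A x -> (f x < n)%N) ->
    (forall x y, A x -> A y -> (f x = f y <-> B (x - y))) ->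
    (forall i, (i < n)%N -> exists2 x, A x & f x = i) ->
  A 0 -> has_index A B n.
Proof.
(* [A 0] makes [n] positive, which supplies the default of [insubd]; on [A] this default is never
   reached. *)
move=> f_lt fB fsur A0; pose f' x : 'I_n := insubd (Ordinal (f_lt 0 A0)) (f x).
have val_f' x : A x -> val (f' x) = f x by move=> Ax; apply: insubdK; apply: (f_lt x Ax).
rewrite -[n]card_ord; apply: (@map_has_index A 'I_n f') => [x y Ax Ay | t].
  rewrite -fB // -!val_f' //; split=> [-> // | ]; first exact: val_inj.
have [x Ax fx] := fsur t (ltn_ord t); exists x => //.
by apply: val_inj; rewrite val_f'.
Qed.

(** As [f] only has to separate cosets, there are at most [#|T|] of them; this yields finiteness
    without the exact count. *)
Lemma finite_map_has_index (A : set G) (T : finType) (f : G -> T) :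
    (forall x y, A x -> A y -> f x = f y -> B (x - y)) ->
  exists n, has_index A B n.
Proof.
move=> fB; apply/finite_setP.
have [r rP] : exists r : T -> G, forall x, A x -> B (x - r (f x)).
  have rep t : exists y, forall x, A x -> f x = t -> B (x - y).
    have [[y [Ay <-]] | no_y] := pselect (exists y, A y /\ f y = t).
      by exists y => x Ax; apply: fB.
    (* Values that [f] does not take on [A] get the dummy representative 0. *)
    by exists 0 => x Ax fx; case: no_y; exists x.
  have [r rP] := choice rep; exists r => x Ax; exact: rP.
apply: (@sub_finite_set _ _ ((fun t => [set z | B (z - r t)]%classic) @` [set: T])%classic).
  by move=> _ [x Ax <-]; exists (f x) => //; apply/esym/coset_eq/rP.
exact/finite_image/finite_finset.
Qed.

End Subgroup.

Section Index.
Variable G : zmodType.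
Implicit Types A B C : set G.

Lemma has_index_quo_order A B n : has_index A B n -> quo_order A B = n.
Proof. exact: card_fset_set. Qed.

Lemma has_index_finite A B n : has_index A B n -> finite_set (cosets A B).
Proof. by move=> ABn; apply/finite_setP; exists n. Qed.

Lemma has_index_uniq A B m n : has_index A B m -> has_index A B n -> m = n.
Proof. by move=> /has_index_quo_order <- /has_index_quo_order. Qed.

Lemma has_index_gt0 A B n : A 0 -> has_index A B n -> (0 < n)%N.
Proof.
move=> A0; rewrite /has_index; case: n => // /card_set_bijP[h [hfun _ _]].
by have := hfun _ (ex_intro2 _ _ 0 A0 erefl); rewrite /= ltn0.
Qed.

(** The conditions say that [phi] induces an isomorphism from [A / B] to [A' / B']: the equivalence
    makes it well defined and injective, the last condition surjective. The isomorphism theorems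
    used below are instances. *)
Lemma has_index_transfer (H : zmodType) (phi : {additive G -> H}) A B (A' B' : set H) n :
    subgroup A -> subgroup B -> subgroup B' ->
    (forall x, A x -> A' (phi x)) -> (forall x, A x -> (B x <-> B' (phi x))) ->
    (forall y, A' y -> exists2 x, A x & B' (y - phi x)) ->
  has_index A' B' n -> has_index A B n.
Proof.
move=> sA sB sB' phiA phiB phiS /(has_index_map sB')[f [f_lt fB fsur]].
apply: (@nat_map_has_index _ _ sB _ _ (f \o phi)) => [x Ax | x y Ax Ay | i lt_in | ] /=.
- exact/f_lt/phiA.
- by rewrite fB ?phiB ?raddfB //; [exact: subgroupB | exact: phiA | exact: phiA].
- have [y A'y <-] := fsur i lt_in; have [x Ax Bxy] := phiS y A'y.
  exists x => //; apply/fB; rewrite ?opprB //; first exact: phiA.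
  by rewrite -opprB; apply: subgroupN.
- exact: subgroup0.
Qed.

(** An element [x] is coded in base [n]: the high digit is its class modulo [B], the low digit the
    class modulo [C] of [x] minus the chosen representative of the high digit. *)
Lemma has_index_mul A B C m n : subgroup A -> subgroup B -> subgroup C ->
    (C `<=` B)%classic -> (B `<=` A)%classic ->
  has_index A B m -> has_index B C n -> has_index A C (m * n).
Proof.
move=> sA sB sC CB BA /(has_index_map sB)[f [f_lt fB fsur]].
case/(has_index_map sC)=> g [g_lt gC gsur].
have [r rP] : exists r : nat -> G, forall x, A x -> A (r (f x)) /\ B (x - r (f x)).
  have rep i : exists y, forall x, A x -> f x = i -> A y /\ B (x - y).
    have [[y [Ay <-]] | no_y] := pselect (exists y, A y /\ f y = i).
      by exists y => x Ax fxy; split=> //; apply/fB.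
    by exists 0 => x Ax fx; case: no_y; exists x.
  have [r rP] := choice rep; exists r => x Ax; exact: rP.
pose h x := (g (x - r (f x))%R + n * f x)%N.
have h_lt x : A x -> (g (x - r (f x))%R < n)%N by move=> Ax; apply/g_lt; case: (rP x Ax).
have h_div x : A x -> (h x %/ n)%N = f x /\ (h x %% n)%N = g (x - r (f x)).
  move=> /h_lt gx; have n0 := leq_ltn_trans (leq0n _) gx.
  by rewrite /h mulnC addnC divnMDl // modnMDl divn_small ?modn_small ?addn0.
have hE x y : A x -> A y -> h x = h y ->
    f x = f y /\ g (x - r (f x)) = g (y - r (f y)).
  by move=> /h_div[<- <-] /h_div[<- <-] ->.
apply: (@nat_map_has_index _ _ sC _ _ h) => [x Ax | x y Ax Ay | i lt_i | ].
- apply: (@leq_trans (n * (f x).+1)); first by rewrite mulnS /h ltn_add2r h_lt.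
  by rewrite mulnC leq_mul2r f_lt // orbT.
- have [Arx Brx] := rP x Ax; have [Ary Bry] := rP y Ay.
  split=> [/hE[] // eq_f eq_g | Cxy].
    by move: eq_g; rewrite gC // -eq_f opprB addrA subrK.
  have eq_f : f x = f y by apply/fB => //; apply: CB.
  rewrite /h; congr (_ + _ * _)%N => //; apply/gC => //.
  by rewrite -eq_f opprB addrA subrK.
- have n0 : (0 < n)%N by case: (n) lt_i; rewrite ?muln0.
  have [x Ax fx] : exists2 x, A x & f x = (i %/ n)%N by apply: fsur; rewrite ltn_divLR.
  have [y By gy] : exists2 y, B y & g y = (i %% n)%N by apply: gsur; rewrite ltn_mod.
  have [Arx Brx] := rP x Ax.
  have Ay : A (y + r (f x)) by apply: subgroupD => //; apply: BA.
  have fy : f (y + r (f x)) = f x.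
    apply/fB => //; rewrite -addrA -opprB; exact: subgroupB.
  exists (y + r (f x)) => //.
  by rewrite /h fy addrK gy fx addnC mulnC -divn_eq.
- exact: subgroup0.
Qed.

(** A code for [A / C] also separates the cosets of [B] in [A] and, restricted to [B], those of [C].
    Hence both indices are finite, and multiplicativity gives their product. *)
Lemma has_index_sub A B C n : subgroup A -> subgroup B -> subgroup C ->
    (C `<=` B)%classic -> (B `<=` A)%classic -> has_index A C n ->
  exists k m, [/\ has_index A B k, has_index B C m & n = (k * m)%N].
Proof.
move=> sA sB sC CB BA ACn; have [f [f_lt fC _]] := has_index_map sC ACn.
have n0 := has_index_gt0 (subgroup0 sA) ACn.
pose f' x : 'I_n := insubd (Ordinal n0) (f x).
have f'E x y : A x -> A y -> f' x = f' y -> C (x - y).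
  move=> Ax Ay /(congr1 val); rewrite !insubdK -?topredE /= ?f_lt // => eq_f.
  exact/fC.
have [k ABk] : exists k, has_index A B k.
  by apply: (finite_map_has_index (f := f') sB) => x y Ax Ay /f'E; move/(_ Ax Ay)/CB.
have [m BCm] : exists m, has_index B C m.
  by apply: (finite_map_has_index (f := f') sC) => x y /BA Ax /BA Ay; apply: f'E.
exists k, m; split=> //; apply: has_index_uniq ACn _.
exact: (has_index_mul sA sB sC CB BA).
Qed.

End Index.

(** * Principal minors and the Cauchy-Binet formula *)

(* Both sides are determinants of multiples of [[x, A], [B, 1]]. *)
Lemma det_scalarB_mulC (R : comNzRingType) m n (x : R) (A : 'M[R]_(m, n)) (B : 'M[R]_(n, m)) :
  x ^+ n * \det (x%:M - A *m B) = x ^+ m * \det (x%:M - B *m A).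
Proof.
pose N := block_mx x%:M A B 1%:M.
have detN : \det N = \det (x%:M - A *m B).
  have <- : \det (N *m block_mx 1%:M 0 (- B) 1%:M) = \det N.
    by rewrite det_mulmx det_lblock !det1 !mulr1.
  rewrite mulmx_block !mulmx1 !mulmx0 !mul1mx addrN add0r mulmxN.
  by rewrite add0r det_ublock det1 mulr1.
rewrite -detN; transitivity (\det (block_mx 1%:M 0 (- B) x%:M *m N)).
  by rewrite det_mulmx det_lblock det1 mul1r det_scalar.
rewrite mulmx_block !mul1mx !mul0mx !addr0 mulmx1 !mulNmx.
rewrite scalar_mxC addNr.
by rewrite det_ublock det_scalar [- _ + _]addrC.
Qed.

(** Distributes the product over the rows in the Leibniz formula; [J] collects the rows in which the
    entry of [A] is picked. *)
Lemma det_addmx_rows (R : comNzRingType) n (A B : 'M[R]_n) :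
  \det (A + B) =
  \sum_(J : {set 'I_n}) \det (\matrix_(i, j) (if i \in J then A i j else B i j)).
Proof.
rewrite exchange_big /=; apply: eq_bigr => s _; rewrite -mulr_sumr; congr (_ * _).
under eq_bigr => i _ do rewrite mxE.
by rewrite bigA_distr; apply: eq_bigr => J _; apply: eq_bigr => i _; rewrite mxE.
Qed.

Definition principal_submx (R : comNzRingType) n (J : {set 'I_n}) (A : 'M[R]_n) : 'M[R]_#|J| :=
  mxsub enum_val enum_val A.

Lemma det_principal_pad (R : comNzRingType) n (J : {set 'I_n}) (x : R) (A : 'M[R]_n) :
  \det (\matrix_(i, j) (if i \in J then A i j else (x%:M : 'M_n) i j)) =
  x ^+ (n - #|J|) * \det (principal_submx J A).
Proof.
pose P : 'M[R]_(#|J|, n) := rowsub enum_val 1%:M.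
have PE (B : 'M[R]_n) : P *m B = rowsub enum_val B by rewrite mul_rowsub_mx mul1mx.
have PtP i j : (P^T *m P) i j = ((i == j) && (i \in J))%:R.
  rewrite mxE; have [Ji | nJi] := boolP (i \in J).
    rewrite (bigD1 (enum_rank_in Ji i)) //= big1 ?addr0 => [|l nli]; last first.
      rewrite !mxE; case: eqP => [eq_i | _]; rewrite ?mul0r //.
      by case/eqP: nli; apply: enum_val_inj; rewrite enum_rankK_in.
    by rewrite !mxE enum_rankK_in // eqxx mul1r andbT.
  rewrite andbF big1 // => l _; rewrite !mxE.
  case: eqP => [eq_i | _]; rewrite ?mul0r //.
  by rewrite -eq_i enum_valP in nJi.
(* [P] selects the rows in [J], so [P^T *m P] is the diagonal projector onto [J]. The second factor
   has the rows of [A] on [J] and those of the identity elsewhere; the first scales the latter by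
   [x]. *)
have -> : (\matrix_(i, j) (if i \in J then A i j else (x%:M : 'M_n) i j)) =
    diag_mx (\row_i (if i \in J then 1 else x)) *m (1%:M - P^T *m (P *m (1%:M - A))).
  rewrite mulmxA mul_diag_mx; apply/matrixP=> i j; rewrite !mxE.
  rewrite (bigD1 i) //= big1 ?addr0 => [|l nli]; last first.
    by rewrite PtP eq_sym (negPf nli) mul0r.
  rewrite PtP eqxx /= !mxE; case: ifP => _; first by rewrite !mul1r opprB addrC subrK.
  by rewrite mul0r subr0 mulr_natr.
rewrite det_mulmx det_diag; congr (_ * _).
  under eq_bigr => i _ do rewrite mxE.
  rewrite big_if /= big1 // mul1r (eq_bigl (mem (~: J)%SET)) => [|i]; last by rewrite !inE.
  by rewrite prodr_const cardsCs finset.setCK card_ord.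
(* Moving [P^T] to the right shrinks the determinant to size [#|J|]; as [P *m P^T] is the identity,
   what remains is [P *m A *m P^T]. *)
have := det_scalarB_mulC 1 P^T (P *m (1%:M - A)).
rewrite !expr1n !mul1r => ->; congr (\det _).
rewrite PE trmx_mxsub trmx1 mulmx_colsub mulmx1; apply/matrixP=> i j.
by rewrite !mxE (inj_eq enum_val_inj) opprB addrC subrK.
Qed.

(** Expanding the sum of [- A] and ['X%:M] by rows, the set [J] contributes ['X^(n - #|J|)] times a
    minor of [- A], so only the sets of size [k] reach this coefficient. *)
Lemma coef_char_poly_minors (R : comNzRingType) n k (A : 'M[R]_n) : (k <= n)%N ->
  (char_poly A)`_(n - k) =
  (-1) ^+ k * \sum_(J : {set 'I_n} | #|J| == k) \det (principal_submx J A).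
Proof.
move=> le_kn; have -> : char_poly A = \det (- map_mx polyC A + 'X%:M) by rewrite addrC.
rewrite det_addmx_rows coef_sum.
rewrite [in RHS]big_mkcond mulr_sumr; apply: eq_bigr => J _.
rewrite det_principal_pad.
have -> : principal_submx J (- map_mx polyC A) = map_mx polyC (- principal_submx J A).
  by apply/matrixP=> i j; rewrite !mxE rmorphN.
rewrite det_map_mx coefMC coefXn -scaleN1r detZ.
have le_Jn : (#|J| <= n)%N by rewrite -[n in (_ <= n)%N]card_ord max_card.
have -> : (n - k == n - #|J|)%N = (#|J| == k).
  by apply/eqP/eqP=> [eq_nk | -> //]; rewrite -(subKn le_Jn) -eq_nk subKn.
by case: eqP => [<- | _]; rewrite ?mul1r ?mul0r ?mulr0.
Qed.

(* Cauchy-Binet, read off the characteristic polynomials of [A *m B] and [B *m A]. *)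
Lemma det_mulmx_minors (R : comNzRingType) k n (A : 'M[R]_(k, n)) (B : 'M[R]_(n, k)) :
  \det (A *m B) = \sum_(W : {set 'I_n} | #|W| == k)
    \det (rowsub (enum_val : 'I_#|W| -> 'I_n) B *m colsub enum_val A).
Proof.
have := det_scalarB_mulC 'X (map_mx polyC A) (map_mx polyC B).
rewrite -!map_mxM -!/(char_poly _) => /(congr1 (fun p : {poly R} => p`_n)).
rewrite !coefXnM ltnn subnn char_poly_det.
have [lt_nk | le_kn] := ltnP n k.
  move=> /(congr1 (fun x => (-1) ^+ k * x)); rewrite mulr0 signrMK => ->.
  by rewrite big1 // => W /eqP cardW; rewrite -cardW ltnNge
    -[n in (_ <= n)%N]card_ord max_card in lt_nk.
rewrite coef_char_poly_minors // => /(congr1 (fun x => (-1) ^+ k * x)).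
rewrite !signrMK => ->; apply: eq_bigr => W _.
by rewrite /principal_submx mxsub_mul.
Qed.

(** * The index of an integer lattice *)

Definition int_span m n (A : 'M[int]_(m, n)) : set 'rV[int]_n :=
  range (fun x : 'rV[int]_m => x *m A).

Lemma subgroupT (G : zmodType) : subgroup [set: G]%classic.
Proof. by []. Qed.

Lemma subgroup_int_span m n (A : 'M[int]_(m, n)) : subgroup (int_span A).
Proof.
split=> [|_ _ [x _ <-] [y _ <-]]; first by exists 0 => //; rewrite mul0mx.
by exists (x - y) => //; rewrite mulmxBl.
Qed.

(** The coset of [x] is given by the residues of its entries modulo those of [d], and all families
    of residues occur. *)
Lemma has_index_diag k (d : 'rV[int]_k) : (forall i, d 0 i != 0) ->
  has_index [set: 'rV[int]_k]%classic (int_span (diag_mx d)) (\prod_i `|d 0%R i|)%N.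
Proof.
(* The form [.-1.+1] makes the ordinals visibly nonempty; it changes nothing, as the entries of [d]
   are nonzero. *)
move=> d_neq0; pose T := {dffun forall i : 'I_k, 'I_(`|d 0%R i|.-1.+1)%N}.
have absd i : (`|d 0%R i|.-1.+1 = `|d 0%R i|)%N by rewrite prednK // absz_gt0.
have modd (x : 'rV[int]_k) i : (`|(x 0%R i %% d 0%R i)%Z| < `|d 0%R i|.-1.+1)%N.
  by rewrite absd -ltz_nat gez0_abs ?modz_ge0 // abszE ltz_mod.
pose f x : T := [ffun i => Ordinal (modd x i)].
have fE x y : f x = f y <-> forall i, (d 0%R i %| x 0%R i - y 0%R i)%Z.
  split=> [/ffunP eq_f i | dvd_xy]; last first.
    apply/ffunP=> i; rewrite !ffunE; apply: val_inj => /=.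
    by move: (dvd_xy i); rewrite -eqz_mod_dvd => /eqP ->.
  move: (eq_f i); rewrite !ffunE => /(congr1 val) /= /(congr1 Posz).
  by rewrite !gez0_abs ?modz_ge0 // => eq_m; rewrite -eqz_mod_dvd; apply/eqP.
have -> : (\prod_i `|d 0%R i|)%N = #|T|.
  rewrite card_dep_ffun foldrE big_map big_enum /=.
  by apply: eq_bigr => i _; rewrite card_ord absd.
apply: (map_has_index (subgroup_int_span _) (f := f)).
  move=> x y _ _; rewrite fE; split=> [dvd_xy | [z _ eq_xy] i].
    exists (\row_i ((x 0%R i - y 0%R i)%R %/ d 0%R i)%Z) => //.
    by rewrite mul_mx_diag; apply/rowP=> i; rewrite !mxE divzK.
  have /rowP/(_ i) := eq_xy; rewrite mul_mx_diag !mxE => <-.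
  exact: dvdz_mull.
move=> t; exists (\row_i (t i : nat)%:Z) => //; apply/ffunP=> i; rewrite ffunE.
apply: val_inj => /=; rewrite mxE -modz_abs modz_small //= ltz_nat.
by apply: leq_trans (ltn_ord _) _; rewrite absd.
Qed.

Lemma absz_det_unitmx k (A : 'M[int]_k) : A \in unitmx -> `|\det A|%N = 1%N.
Proof. move=> uA; have /(congr1 (absz \o determinant)) := mulmxV uA.
by rewrite /= det_mulmx det1 abszM => /eqP; rewrite muln_eq1 => /andP[/eqP]. Qed.

(** In the Smith form [L *m D *m R], multiplication by the inverse of [R] is an automorphism of the
    ambient lattice, and [L] does not change the row lattice of [D]. Both have determinant of
    absolute value 1. *)
Lemma has_index_det k (A : 'M[int]_k) : \det A != 0 ->
  has_index [set: 'rV[int]_k]%classic (int_span A) `|\det A|%N.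
Proof.
have [L uL [R uR [d _ ->]]] := int_Smith_normal_form A.
pose D : 'rV[int]_k := \row_i d`_i.
have -> : \matrix_(i, j) (d`_i *+ (i == j :> nat)) = diag_mx D.
  by apply/matrixP=> i j; rewrite !mxE.
rewrite !det_mulmx !abszM (absz_det_unitmx uL) (absz_det_unitmx uR) mul1n muln1 det_diag => detD.
rewrite (big_morph _ abszM (erefl `|1%Z|%N)) !mulf_eq0 !negb_or in detD *.
apply: (has_index_transfer (phi := mulmxr (invmx R)) (subgroupT _) _ _ _ _ _ (has_index_diag _)).
- exact: subgroup_int_span.
- exact: subgroup_int_span.
- by [].
- move=> x _ /=; split=> [[y _ <-] | [y _ eq_y]].
    by exists (y *m L) => //; rewrite !mulmxA mulmxK.
  exists (y *m invmx L) => //; rewrite !mulmxA mulmxKV //.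
  by rewrite eq_y /= mulmxKV.
- move=> y _; exists (y *m R) => //; rewrite /= mulmxK // subrr.
  exact: subgroup0 (subgroup_int_span _).
- by case/andP: detD => /andP[_ /prodf_neq0 Dn0] _ i; apply: Dn0.
Qed.

(** * Sums and saturations of subgroups *)

Definition setsum (G : zmodType) (A B : set G) : set G :=
  [set a + b | a in A & b in B]%classic.

(** The saturation of [B] in [A]. For cycles and boundaries it is the numerator in
    [torsion_order]. *)
Definition torsion_in (G : zmodType) (A B : set G) : set G :=
  [set c | A c /\ exists2 m, (0 < m)%N & B (c *+ m)]%classic.

Section Sums.
Variable G : zmodType.
Implicit Types A B C : set G.

Lemma subgroup_setsum A B : subgroup A -> subgroup B -> subgroup (setsum A B).
Proof.
move=> sA sB; split=> [|_ _ [a Aa [b Bb <-]] [a' Aa' [b' Bb' <-]]].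
  by exists 0; [exact: subgroup0 | exists 0; [exact: subgroup0 | rewrite addr0]].
exists (a - a'); first exact: subgroupB.
by exists (b - b'); [exact: subgroupB | rewrite opprD addrACA].
Qed.

Lemma subgroup_torsion_in A B : subgroup A -> subgroup B -> subgroup (torsion_in A B).
Proof.
move=> sA sB; split=> [|x y [Ax [m m0 Bx]] [Ay [n n0 By]]].
  by split; [exact: subgroup0 | exists 1%N => //; rewrite mulr1n; apply: subgroup0].
split; first exact: subgroupB.
exists (m * n)%N; first by rewrite muln_gt0 m0.
by rewrite mulrnBl mulrnA [(m * n)%N]mulnC mulrnA; apply: subgroupB => //; apply: subgroupMn.
Qed.

Lemma subgroupI A B : subgroup A -> subgroup B -> subgroup (A `&` B)%classic.
Proof.
move=> sA sB; split=> [|x y [Ax Bx] [Ay By]]; split;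
  by [exact: subgroup0 | exact: subgroupB].
Qed.

Lemma setsumSl A B C : (A `<=` B)%classic -> (setsum A C `<=` setsum B C)%classic.
Proof. by move=> AB _ [a /AB Ba [c Cc <-]]; exists a => //; exists c. Qed.

Lemma subset_torsion_in A B : (B `<=` A)%classic -> (B `<=` torsion_in A B)%classic.
Proof. by move=> BA x Bx; split; [exact: BA | exists 1%N]. Qed.

(** Pigeonhole: among the multiples of [x] by 0, ..., [n], two lie in the same coset. *)
Lemma has_index_torsion A B n x : subgroup A -> subgroup B -> has_index A B n -> A x ->
  exists2 m, (0 < m)%N & B (x *+ m).
Proof.
move=> sA sB ABn Ax; have [f [f_lt fB _]] := has_index_map sB ABn.
pose g (i : 'I_n.+1) : 'I_n := Ordinal (f_lt _ (subgroupMn sA i Ax)).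
have /injectivePn[i [j ne_ij /(congr1 val) /= eq_f]] : ~~ injectiveb g.
  by apply/injectiveP => /leq_card; rewrite !card_ord ltnn.
have mulB (k l : 'I_n.+1) : f (x *+ k) = f (x *+ l) -> B (x *+ k - x *+ l).
  by apply: (fB _ _ _ _).1; apply: subgroupMn.
wlog lt_ij : i j ne_ij eq_f / (i < j)%N.
  move=> IH; have [lt_ij | lt_ji | /val_inj eq_ij] := ltngtP i j.
  - exact: IH lt_ij.
  - by apply: IH lt_ji => //; rewrite eq_sym.
  - by rewrite eq_ij eqxx in ne_ij.
exists (j - i)%N; first by rewrite subn_gt0.
by rewrite mulrnBr 1?ltnW //; apply: mulB.
Qed.

End Sums.

Lemma subgroup_image (G H : zmodType) (phi : {additive G -> H}) (A : set G) :
  subgroup A -> subgroup (phi @` A)%classic.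
Proof.
move=> sA; split=> [|_ _ [x Ax <-] [y Ay <-]].
  by exists 0; [exact: subgroup0 | rewrite raddf0].
by exists (x - y); [exact: subgroupB | rewrite raddfB].
Qed.

(** * The chain of indices behind the weight *)

Section Weight.
Variables (G H : zmodType) (phi : {additive G -> H}) (L P : set G) (C : set H).

Let Z : set G := [set c | phi c = 0]%classic.
Let S : set G := torsion_in Z L.

(** [phi] stands for the boundary and [C] for the cycles one degree below. The indices along
    [L + P], [S + P], [Z + P], [G] multiply to [N], and the top one is [tP / t]; the equation is
    stated without this division. *)
Lemma has_index_weight N t tP :
    subgroup L -> subgroup P -> subgroup C -> (L `<=` Z)%classic ->
    (forall h, range phi h -> C h) -> (forall c, S c -> P c -> c = 0) ->
    has_index [set: G]%classic (setsum L P) N ->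
    has_index (torsion_in C (range phi)) (range phi) t ->
    has_index (torsion_in C (phi @` P)%classic) (phi @` P)%classic tP ->
  exists a b, [/\ has_index S L a, has_index Z (setsum S (Z `&` P)%classic) b
                & (N * t = a * tP * b)%N].
Proof.
move=> sL sP sC LZ phiC SP0 GLP Tt TPt.
have sZ : subgroup Z.
  by split=> [|x y Zx Zy]; rewrite /Z /= ?raddf0 // raddfB Zx Zy subr0.
have sS : subgroup S by apply: subgroup_torsion_in.
have sT := subgroupT G.
have [sZP sSP sLP] : [/\ subgroup (setsum Z P), subgroup (setsum S P) & subgroup (setsum L P)].
  by split; apply: subgroup_setsum.
have sphi : subgroup (range phi) by apply: subgroup_image.
have sphiP : subgroup (phi @` P)%classic by apply: subgroup_image.
have LS : (L `<=` S)%classic by apply: subset_torsion_in.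
have SZ : (S `<=` Z)%classic by move=> c [].
(* As [L + P] has finite index, a positive multiple of any [x] lies in it; [phi] kills [L], so that
   multiple of [phi x] is the image of an element of [P]. *)
have eqT : torsion_in C (phi @` P)%classic = torsion_in C (range phi).
  apply/seteqP; split=> h [Ch [m m0]].
    by case=> x Px eq_h; split=> //; exists m => //; exists x.
  case=> x _ eq_h; split=> //; have [m' m'0] := has_index_torsion sT sLP GLP I (x := x).
  case=> l Ll [p Pp eq_x]; exists (m * m')%N; first by rewrite muln_gt0 m0.
  exists p => //; rewrite mulrnA -eq_h -raddfMn /= -eq_x raddfD /=.
  by rewrite (LZ l Ll) add0r.
have [n1 [n23 [GZP ZLP eqN]]] :=
  has_index_sub sT sZP sLP (setsumSl (subset_trans LS SZ)) (fun _ _ => I) GLP.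
have [n2 [n3 [ZSP SLP eqn23]]] := has_index_sub sZP sSP sLP (setsumSl LS) (setsumSl SZ) ZLP.
rewrite eqT in TPt.
have phiP_sub : (phi @` P `<=` range phi)%classic by move=> _ [p _ <-]; exists p.
have phi_sub : (range phi `<=` torsion_in C (range phi))%classic.
  exact: subset_torsion_in.
have [t' [k [Tt' phiPk eqtP]]] :=
  has_index_sub (subgroup_torsion_in sC sphi) sphi sphiP phiP_sub phi_sub TPt.
(* [phi] has kernel [Z], so it identifies [G / (Z + P)] with the quotient of its image by the image
   of [P]. *)
have GZPk : has_index [set: G]%classic (setsum Z P) k.
  apply: (has_index_transfer (phi := phi) sT sZP sphiP _ _ _ phiPk).
  - by move=> x _; exists x.
  - move=> x _; split=> [[z Zz [p Pp <-]] | [p Pp eq_px]].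
      by exists p => //; rewrite raddfD /= Zz add0r.
    exists (x - p); first by rewrite /Z /= raddfB /= eq_px subrr.
    by exists p => //; rewrite subrK.
  - by move=> _ [x _ <-]; exists x => //; rewrite subrr; apply: subgroup0.
exists n3, n2; split.
(* [S / L] is isomorphic to [(S + P) / (L + P)] because [S] and [P] meet only in 0. *)
- apply: (has_index_transfer (phi := @idfun G) sS sL sLP _ _ _ SLP).
  + by move=> x Sx; exists x => //; exists 0; [exact: subgroup0 | rewrite addr0].
  + move=> x Sx; split=> [Lx | [l Ll [p Pp eq_x]]].
      by exists x => //; exists 0; [exact: subgroup0 | rewrite addr0].
    rewrite /= in eq_x; suff p0 : p = 0 by rewrite -eq_x p0 addr0.
    apply: SP0 => //; rewrite -[p](addKr l) eq_x addrC.
    by apply: subgroupB => //; apply: LS.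
  + move=> _ [s Ss [p Pp <-]]; exists s => //; rewrite /= addrC addKr.
    by exists 0; [exact: subgroup0 | exists p => //; rewrite add0r].
- have sSZP : subgroup (setsum S (Z `&` P)%classic).
    by apply: subgroup_setsum => //; apply: subgroupI.
  (* Modular law: as [S] lies in [Z], the intersection of [Z] with [S + P] is [S] plus the
     intersection of [Z] and [P]. *)
  apply: (has_index_transfer (phi := @idfun G) sZ sSZP sSP _ _ _ ZSP).
  + by move=> x Zx; exists x => //; exists 0; [exact: subgroup0 | rewrite addr0].
  + move=> x Zx; split=> [[s Ss [p [Zp Pp] eq_x]] | [s Ss [p Pp /= eq_x]]].
      by exists s => //; exists p.
    exists s => //; exists p => //; split=> //; rewrite -[p](addKr s) eq_x addrC.
    by apply: subgroupB => //; apply: SZ.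
  + move=> _ [z Zz [p Pp <-]]; exists z => //; rewrite /= addrC addKr.
    by exists 0; [exact: subgroup0 | exists p => //; rewrite add0r].
- rewrite eqN eqn23 eqtP (has_index_uniq GZP GZPk) (has_index_uniq Tt' Tt).
  by rewrite [(k * _)%N]mulnC -mulnA (mulnC k t) -mulnA [RHS]mulnC.
Qed.

End Weight.

(** * Rational spans and torsion of lattices *)

Local Notation intQ A := (map_mx (intr : int -> rat) A).

Lemma common_denominator m n (Q : 'M[rat]_(m, n)) :
  exists2 M, (0 < M)%N & exists N : 'M[int]_(m, n), Q *+ M = intQ N.
Proof.
pose M := (\prod_i \prod_j `|denq (Q i j)|)%N.
have M0 : (0 < M)%N.
  by apply: prodn_gt0 => i; apply: prodn_gt0 => j; rewrite absz_gt0 denq_neq0.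
have dvdM i j : (`|denq (Q i j)| %| M)%N.
  apply: (@dvdn_trans (\prod_j `|denq (Q i j)|)%N).
    by rewrite (bigD1 j) //= dvdn_mulr.
  by rewrite /M (bigD1 i) //= dvdn_mulr.
exists M => //; exists (\matrix_(i, j) (numq (Q i j) *+ (M %/ `|denq (Q i j)|))).
apply/matrixP=> i j; rewrite mulmxnE !mxE rmorphMn /= -{1}[Q i j]divq_num_den.
rewrite -{1}(divnK (dvdM i j)) mulnC mulrnA; congr (_ *+ _).
by rewrite -mulr_natr pmulrn absz_denq divfK // intr_eq0 denq_neq0.
Qed.

Lemma intQ_inj m n : injective (fun A : 'M[int]_(m, n) => intQ A).
Proof.
move=> A B /matrixP eqAB; apply/matrixP=> i j; have := eqAB i j.
by rewrite !mxE => /intr_inj.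
Qed.

(** Clears denominators in one direction and divides by [M] in the other. It links the rational
    boundaries in [tprime_order] to [torsion_in]. *)
Lemma rat_span_torsion m n (A : 'M[int]_(m, n)) (c : 'rV[int]_n) :
  (exists q : 'rV[rat]_m, q *m intQ A = intQ c) <->
  exists2 M, (0 < M)%N & int_span A (c *+ M).
Proof.
split=> [[q eq_c] | [M M0 [x _ eq_x]]].
  have [M M0 [x eq_x]] := common_denominator q; exists M => //; exists x => //.
  by apply: intQ_inj; rewrite map_mxM -eq_x -scaler_nat -scalemxAl eq_c scaler_nat raddfMn.
exists (M%:R^-1 *: intQ x); rewrite -scalemxAl -map_mxM eq_x raddfMn /= -scaler_nat.
by rewrite scalerK // pnatr_eq0 -lt0n.
Qed.

(** [M] is a common denominator of the pseudo-inverse of [A], which recovers the coefficients of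
    every vector in the rational row span. *)
Lemma torsion_exponent m n (A : 'M[int]_(m, n)) :
  exists2 M, (0 < M)%N & forall c k, (0 < k)%N -> int_span A (c *+ k) -> int_span A (c *+ M).
Proof.
have [M M0 [N eqN]] := common_denominator (pinvmx (intQ A)).
exists M => // c k k0 Ack; exists (c *m N) => //; apply: intQ_inj.
have /rat_span_torsion[q eq_q] : exists2 k, (0 < k)%N & int_span A (c *+ k) by exists k.
rewrite !map_mxM -eqN -scaler_nat -scalemxAr -scalemxAl mulmxKpV ?scaler_nat ?raddfMn //.
by rewrite -eq_q submxMl.
Qed.

(** Classes are separated by reduction modulo the exponent [M]: if two torsion elements differ by
    [M] times a vector, that vector is torsion too, and [M] brings it into the lattice. *)
Lemma finite_torsion m n (A : 'M[int]_(m, n)) (C : set 'rV[int]_n) :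
  subgroup C -> exists k, has_index (torsion_in C (int_span A)) (int_span A) k.
Proof.
move=> sC; have [M M0 expM] := torsion_exponent A.
have sA := subgroup_int_span A.
have lt_mod (x : 'rV[int]_n) i : (`|(x 0%R i %% M)%Z| < M)%N.
  by rewrite -ltz_nat gez0_abs ?modz_ge0 ?ltz_mod // -lt0n.
pose f x : {ffun 'I_n -> 'I_M} := [ffun i => Ordinal (lt_mod x i)].
apply: (finite_map_has_index (f := f) sA) => x y Ax Ay /ffunP eq_f.
have [Cxy [k k0 Axy]] := subgroupB (subgroup_torsion_in sC sA) Ax Ay.
have eq_xy : x - y = (\row_i ((x 0%R i - y 0%R i)%R %/ M)%Z) *+ M.
  apply/rowP=> i; rewrite mulmxnE !mxE -mulr_natr natz divzK // -eqz_mod_dvd.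
  have := eq_f i; rewrite !ffunE => /(congr1 val) /= /(congr1 Posz).
  by rewrite !gez0_abs ?modz_ge0 -?lt0n // => ->.
rewrite eq_xy; apply: (expM _ (M * k)%N); first by rewrite muln_gt0 M0.
by rewrite mulrnA -eq_xy.
Qed.

(** * Chains that avoid a set of cells, and minors *)

Definition vanishing (R : nzRingType) n (W : {set 'I_n}) : set 'rV[R]_n :=
  [set c | forall x, x \in W -> c 0 x = 0]%classic.

Lemma subgroup_vanishing (R : nzRingType) n (W : {set 'I_n}) :
  subgroup (vanishing (R := R) W).
Proof.
by split=> [x _ | c c' c0 c'0 x xW]; rewrite !mxE // c0 // c'0 // subr0.
Qed.

Local Notation cols W := (colsub (enum_val : 'I_#|W| -> _)).

Lemma vanishingE (R : nzRingType) n (W : {set 'I_n}) (c : 'rV[R]_n) :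
  vanishing W c <-> cols W c = 0.
Proof.
split=> [c0 | /rowP c0 x xW]; first by apply/rowP=> i; rewrite !mxE c0 ?enum_valP.
by have := c0 (enum_rank_in xW x); rewrite !mxE enum_rankK_in.
Qed.

(** Projection to the coordinates in [W] is onto with kernel [vanishing W], so the quotient becomes
    that of a square lattice, to which [has_index_det] applies. *)
Lemma has_index_span_vanishing n (W : {set 'I_n}) (D : 'M[int]_(#|W|, n)) :
  \det (cols W D) != 0 ->
  has_index [set: 'rV[int]_n]%classic (setsum (int_span D) (vanishing W))
    `|\det (cols W D)|%N.
Proof.
move=> detD.
have colsE (x : 'rV[int]_n) : x *m cols W 1%:M = cols W x by rewrite mulmx_colsub mulmx1.
have colsM (y : 'rV[int]_#|W|) : y *m cols W D = cols W (y *m D) by rewrite mulmx_colsub.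
have sP := subgroup_vanishing int W.
apply: (has_index_transfer (phi := mulmxr (cols W 1%:M)) (subgroupT _) _ _ _ _ _
  (has_index_det detD)).
- by apply: subgroup_setsum => //; apply: subgroup_int_span.
- exact: subgroup_int_span.
- by [].
- move=> x _ /=; rewrite colsE; split=> [[_ [y _ <-] [p Pp <-]] | [y _]].
    by exists y => //; rewrite colsM raddfD /= ((vanishingE W p).1 Pp) addr0.
  rewrite colsM => eq_x; exists (y *m D); first by exists y.
  exists (x - y *m D); last by rewrite addrC subrK.
  by apply/vanishingE; rewrite raddfB /= eq_x subrr.
- move=> y _; exists (y *m rowsub enum_val 1%:M) => //=.
  have -> : y *m rowsub enum_val 1%:M *m cols W 1%:M = y.
    rewrite -mulmxA -mxsub_mul mulmx1 -[RHS]mulmx1; congr (_ *m _).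
    by apply/matrixP=> i j; rewrite !mxE (inj_eq enum_val_inj).
  rewrite subrr; exact: subgroup0 (subgroup_int_span _).
Qed.

(** As [k] and [#|W|] are only provably equal, the squared minor is written as the determinant of a
    product, which is square by its type and has the shape of a Cauchy-Binet term. *)
Lemma det_cols_sqr k n (D : 'M[int]_(k, n)) (W : {set 'I_n}) : k = #|W| ->
    let A := intQ D in
    row_free (cols W A) ->
  exists N, [/\ has_index [set: 'rV[int]_n]%classic (setsum (int_span D) (vanishing W)) N,
    N%:R ^+ 2 = \det (rowsub (enum_val : 'I_#|W| -> _) A^T *m cols W A)
    & forall x : 'rV[int]_k, cols W (x *m D) = 0 -> x = 0].
Proof.
move=> eq_k /=; subst k; rewrite -map_mxsub row_free_unit unitmxE unitfE det_map_mx intr_eq0.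
move=> detD; exists `|\det (cols W D)|%N; split=> [||x x0].
- exact: has_index_span_vanishing.
- rewrite -trmx_mxsub -map_mxsub det_mulmx det_tr det_map_mx -expr2.
  by rewrite natr_absz intr_norm real_normK // num_real.
- apply: intQ_inj; rewrite raddf0; apply: (row_free_inj (A := intQ (cols W D))).
    by rewrite row_free_unit unitmxE unitfE det_map_mx intr_eq0.
  by rewrite -map_mxM mulmx_colsub x0 mul0mx raddf0.
Qed.

Lemma enum_val_image (T : finType) (A : {set T}) : (enum_val : 'I_#|A| -> T) @: 'I_#|A| = A.
Proof.
apply/setP=> x; apply/imsetP/idP => [[i _ ->] | xA]; first exact: enum_valP.
by exists (enum_rank_in xA x); rewrite ?enum_rankK_in.
Qed.

(** * Chains supported on a set of cells *)

Section Rows.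
Variables (R : nzRingType) (k m : nat) (p : 'I_k -> 'I_m) (U : {set 'I_m}).
Hypotheses (p_inj : injective p) (pU : p @: 'I_k = U).

(** The enumeration [p] of [U] is arbitrary because a subset of the forest is later enumerated by a
    composite of two [enum_val]. *)
Lemma supported_image n (A : 'M[R]_(m, n)) :
  [set c *m A | c in [set c : 'rV[R]_m | forall x, x \notin U -> c 0 x = 0]]%classic =
  range (fun x : 'rV[R]_k => x *m rowsub p A).
Proof.
apply/seteqP; split=> [_ [c cU <-] | _ [x _ <-]]; last first.
  (* This witness is the extension of [x] by zero outside [U]. *)
  exists (x *m rowsub p 1%:M); last by rewrite -mulmxA mul_rowsub_mx mul1mx.
  move=> j jU; rewrite mxE big1 // => i _; rewrite !mxE; case: eqP => [eq_j | _].
    by rewrite -pU -eq_j imset_f in jU.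
  by rewrite mulr0.
exists (colsub p c) => //.
apply/rowP=> j; rewrite !mxE (bigID (mem U)) /= [X in _ + X]big1 ?addr0 => [|i iU].
  by rewrite -pU big_imset /= => [|? ? _ _ /p_inj //]; apply: eq_bigr => i _; rewrite !mxE.
by rewrite cU ?mul0r.
Qed.

Lemma rowsub_mulmx_eq0 n (A : 'M[R]_(m, n)) (x : 'rV[R]_k) :
    (forall c : 'rV[R]_m, (forall j, j \notin U -> c 0 j = 0) -> c *m A = 0 -> c = 0) ->
  x *m rowsub p A = 0 -> x = 0.
Proof.
move=> A0 x0; have c0 : x *m rowsub p 1%:M = 0.
  apply: A0; last by rewrite -mulmxA mul_rowsub_mx mul1mx.
  move=> j jU; rewrite mxE big1 // => i _; rewrite !mxE; case: eqP => [eq_j | _].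
    by rewrite -pU -eq_j imset_f in jU.
  by rewrite mulr0.
rewrite -[x]mulmx1 (_ : 1%:M = rowsub p 1%:M *m colsub p 1%:M) ?mulmxA ?c0 ?mul0mx //.
by rewrite -mxsub_mul mulmx1; apply/matrixP=> i j; rewrite !mxE (inj_eq p_inj).
Qed.

End Rows.

(** * Cellular chains and coforests as matrices *)

Section Cells.
Variable X : finCW.

Lemma attach_eq (Y : subcx X) i (W : {set cells X i}) : attach Y W i = W.
Proof.
apply/setP=> x; rewrite inE ltnn eqxx /=; apply/exists_inP/idP => [[w Ww] | Wx].
  by rewrite val_eqE => /eqP <-.
by exists x.
Qed.

Lemma attach_lt (Y : subcx X) i (W : {set cells X i}) j : (j < i)%N -> attach Y W j = Y j.
Proof. by move=> lt_ji; apply/setP=> x; rewrite inE lt_ji ltn_eqF // orbF. Qed.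

Lemma chains_whole (R : nzRingType) i c : chains R (whole X) i c.
Proof. by move=> x; rewrite inE. Qed.

Lemma chains_attach_lt (R : nzRingType) i (W : {set cells X i}) j c : (j < i)%N ->
  chains R (attach (whole X) W) j c.
Proof. by move=> lt_ji x; rewrite attach_lt // inE. Qed.

Lemma chains_attach_compl (R : nzRingType) i (W : {set cells X i}) :
  chains R (attach (whole X) (~: W)%SET) i = vanishing W.
Proof.
rewrite /chains attach_eq; apply/seteqP; split=> c c0 x xW.
  by apply: c0; rewrite inE xW.
by apply: c0; rewrite inE negbK in xW.
Qed.

Lemma bounds_attach (R : nzRingType) i k (p : 'I_k -> cells X i.+1) U :
    injective p -> p @: 'I_k = U ->
  bounds R (attach (whole X) U) i =
  range (fun x : 'rV[R]_k => x *m rowsub p (map_mx intr (incidence X i))).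
Proof. by move=> p_inj pU; rewrite /bounds /chains attach_eq (supported_image p_inj pU). Qed.

Lemma map_mx_intz m n (A : 'M[int]_(m, n)) : map_mx intr A = A.
Proof. by apply/matrixP=> i j; rewrite mxE intz. Qed.

Lemma bounds_attach_int i k (p : 'I_k -> cells X i.+1) U :
    injective p -> p @: 'I_k = U ->
  bounds int (attach (whole X) U) i = int_span (rowsub p (incidence X i)).
Proof. by move=> p_inj pU; rewrite (bounds_attach _ p_inj pU) map_mx_intz. Qed.

(** Independent rows identify the rational boundaries with coefficient vectors; restriction to [W]
    then becomes multiplication by the columns in [W], injective when these are row free and onto
    when they are row full. *)
Lemma spanning_coforestP i k (p : 'I_k -> cells X i.+1) U (W : {set cells X i}) :
    injective p -> p @: 'I_k = U -> row_free (intQ (rowsub p (incidence X i))) ->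
  spanning_coforest (attach (whole X) U) W <->
  row_free (cols W (intQ (rowsub p (incidence X i)))) /\
  row_full (cols W (intQ (rowsub p (incidence X i)))).
Proof.
move=> p_inj pU; set A := intQ _ => freeA.
have boundsE : bounds rat (attach (whole X) U) i = range (fun x : 'rV[rat]_k => x *m A).
  by rewrite (bounds_attach _ p_inj pU) /A map_mxsub.
have colsE (x : 'rV[rat]_k) : x *m cols W A = cols W (x *m A) by rewrite mulmx_colsub.
have restrict_eq (c c' : 'rV[rat]_(ncells X i)) :
    Defs.restrict W c = Defs.restrict W c' <-> cols W c = cols W c'.
  split=> /rowP eq_c; apply/rowP=> j; rewrite !mxE.
    by have := eq_c (enum_val j); rewrite !mxE enum_valP.
  case: ifP => // jW; have := eq_c (enum_rank_in jW j).
  by rewrite !mxE enum_rankK_in.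
rewrite /spanning_coforest boundsE /chains attach_eq.
split=> [[_ [_ Winj Wsur]] | [/row_freeP[A' AK] /row_fullP[B BK]]].
  split.
    apply: inj_row_free => x x0; apply: (row_free_inj freeA); rewrite mul0mx.
    apply: Winj; [by apply/mem_set; exists x | by apply/mem_set; exists 0; rewrite ?mul0mx | ].
    by apply/restrict_eq; rewrite -colsE x0 raddf0.
  (* Surjectivity is applied to [y] extended by zero outside [W]; solving for the unit vectors
     yields a left inverse. *)
  have solve (y : 'rV[rat]_#|W|) : exists x, x *m cols W A = y.
    have [|_ [x _ <-] eq_y] := Wsur (y *m rowsub enum_val 1%:M).
      move=> j jW; rewrite mxE big1 // => l _; rewrite !mxE; case: eqP => [eq_j | _].
        by rewrite -eq_j enum_valP in jW.
      by rewrite mulr0.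
    exists x; rewrite colsE; apply/rowP=> l; have /rowP/(_ (enum_val l)) := eq_y.
    rewrite !mxE enum_valP => ->; rewrite (bigD1 l) //= big1 ?addr0 => [|l' ne_l].
      by rewrite !mxE eqxx mulr1.
    by rewrite !mxE (inj_eq enum_val_inj) (negPf ne_l) mulr0.
  apply/row_fullP; have [B BP] := choice (fun l => solve (delta_mx 0 l)).
  exists (\matrix_l B l); apply/row_matrixP=> l.
  by rewrite row_mul rowK BP row1.
split; first by apply/fintype.subsetP=> j _; rewrite attach_lt // inE.
split.
- by move=> _ [x _ <-] j jW; rewrite mxE (negPf jW).
- move=> _ _ /set_mem[x _ <-] /set_mem[y _ <-] /restrict_eq; rewrite -!colsE.
  by move/(congr1 (mulmx^~ A')); rewrite -!mulmxA AK !mulmx1 => ->.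
- move=> c cW; exists (cols W c *m B *m A); first by exists (cols W c *m B).
  have eq_c : c = Defs.restrict W c.
    by apply/rowP=> j; rewrite mxE; case: ifPn => // /cW.
  by rewrite [RHS]eq_c; apply/restrict_eq; rewrite -colsE -mulmxA BK mulmx1.
Qed.

End Cells.

(** * The relative homology of a coforest *)

Section RelativeHomology.
Variables (X : finCW) (e k : nat) (p : 'I_k -> cells X e.+2).
Variables (U : {set cells X e.+2}) (W : {set cells X e.+1}).

Let XU := attach (whole X) U.
Let XC := attach (whole X) (~: W)%SET.
Let D := rowsub p (incidence X e.+1).
Let dE : {additive 'rV[int]_(ncells X e.+1) -> 'rV[int]_(ncells X e)} :=
  mulmxr (incidence X e).

Hypotheses (p_inj : injective p) (pU : p @: 'I_k = U).
Hypothesis freeD : row_free (intQ D).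
Hypothesis cofW : spanning_coforest XU W.

(** Instance of [has_index_weight] with [dE] as [phi], the row lattice of [D] as [L] and
    [vanishing W] as [P]. Positivity of the torsion order of [X] permits the division made in the
    theorem. *)
Lemma relH_weight :
  [/\ relH_finite XU XC e.+1,
    (relH_order XU XC e.+1)%:R ^+ 2 =
      \det (rowsub (enum_val : 'I_#|W| -> _) (intQ D)^T *m cols W (intQ D))
    & (relH_order XU XC e.+1 * torsion_order (whole X) e =
       torsion_order XU e.+1 * torsion_order XC e * tprime_order XU XC e.+1)%N
      /\ (0 < torsion_order (whole X) e)%N].
Proof.
have [freeW fullW] := (spanning_coforestP W p_inj pU freeD).1 cofW.
have eq_k : k = #|W| by rewrite -(eqP freeW) (eqP fullW).
have [N [DN sqrN DW0]] := det_cols_sqr eq_k freeW.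
pose Z := [set c | dE c = 0]%classic; pose P : set 'rV[int]_(ncells X e.+1) := vanishing W.
pose C := cycles int (whole X) e.
have sD := subgroup_int_span D; have sP : subgroup P by apply: subgroup_vanishing.
have boundsU : bounds int XU e.+1 = int_span D by apply: bounds_attach_int.
have boundsC : bounds int XC e = (dE @` P)%classic.
  by rewrite /bounds chains_attach_compl; apply: eq_imagel => c _; rewrite /boundary /= map_mx_intz.
have boundsX : bounds int (whole X) e = range dE.
  rewrite /bounds; apply/seteqP; split=> _ [c _ <-]; exists c => //=.
  - by rewrite map_mx_intz.
  - exact: chains_whole.
  - by rewrite map_mx_intz.
have cyclesX : cycles int (whole X) e.+1 = Z.
  apply/seteqP; split=> c; rewrite /cycles /= map_mx_intz; first by case.
  by split=> //; apply: chains_whole.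
have cyclesU : cycles int XU e.+1 = Z.
  apply/seteqP; split=> c; rewrite /cycles /= map_mx_intz; first by case.
  by split=> //; apply: chains_attach_lt.
have cyclesC : cycles int XC e.+1 = (Z `&` P)%classic.
  rewrite /cycles chains_attach_compl; apply/seteqP; split=> c; rewrite /boundary /= map_mx_intz;
  by case.
have cyclesC' : cycles int XC e = C.
  apply/seteqP; split=> c [_ c0]; split=> //; first exact: chains_whole.
  exact: chains_attach_lt.
have sC : subgroup C.
  split=> [|x y [_ x0] [_ y0]]; split; try exact: chains_whole.
    by rewrite /boundary; case: (e) => // i; rewrite mul0mx.
  by move: x0 y0; rewrite /boundary; case: (e) x y => // i x y x0 y0; rewrite mulmxBl x0 y0 subr0.
have DZ : (int_span D `<=` Z)%classic.
  by move=> _ [x _ <-]; rewrite /Z /= -mulmxA mul_rowsub_mx incidenceK raddf0 mulmx0.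
have dEC h : range dE h -> C h.
  case=> c _ <-; split; first exact: chains_whole.
  rewrite /dE /boundary /=; case: (e) c => // i c.
  by rewrite map_mx_intz -mulmxA incidenceK mulmx0.
(* A positive multiple of [c] is [x *m D] and vanishes on [W], where [D] is injective; so [x], that
   multiple and [c] are zero. *)
have SP0 c : torsion_in Z (int_span D) c -> P c -> c = 0.
  move=> [_ [m m0 [x _ eq_x]]] /vanishingE Pc; have x0 : x = 0.
    by apply: DW0; rewrite eq_x raddfMn /= Pc mul0rn.
  move/rowP: eq_x => eq_x; apply/rowP=> j; move/eqP: (eq_x j).
  by rewrite x0 mul0mx mulmxnE !mxE eq_sym mulrn_eq0 eqn0Ngt m0 => /eqP.
have [t Ht] := finite_torsion (incidence X e) sC.
(* Writing the boundaries of [XC] as a row lattice makes [finite_torsion] applicable. *)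
have dEP : (dE @` P)%classic = int_span (rowsub enum_val (incidence X e) : 'M_(#|(~: W)%SET|, _)).
  by rewrite -boundsC; apply: bounds_attach_int; [exact: enum_val_inj | exact: enum_val_image].
have [tP HtP] := finite_torsion (rowsub enum_val (incidence X e) : 'M_(#|(~: W)%SET|, _)) sC.
rewrite -dEP in HtP.
have [a [b [Ha Hb eqN]]] := has_index_weight sD sP sC DZ dEC SP0 DN Ht HtP.
(* Every chain is a relative cycle, since [XU] has all cells of degree [e.+1] and [XC] all those of
   degree [e]. *)
have relH : has_index (@relcycles X XU XC e.+1) (@relbounds X XU XC e.+1) N.
  rewrite (_ : @relcycles X XU XC e.+1 = setT).
    by rewrite /relbounds boundsU chains_attach_compl.
  by apply/seteqP; split=> // c _; split; apply: chains_attach_lt.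
have orderH := has_index_quo_order relH.
have orderX : torsion_order (whole X) e = t.
  by rewrite /torsion_order boundsX; apply: has_index_quo_order Ht.
have orderU : torsion_order XU e.+1 = a.
  by rewrite /torsion_order cyclesU boundsU; apply: has_index_quo_order Ha.
have orderC : torsion_order XC e = tP.
  by rewrite /torsion_order cyclesC' boundsC; apply: has_index_quo_order HtP.
have order' : tprime_order XU XC e.+1 = b.
  rewrite /tprime_order cyclesX cyclesC -(has_index_quo_order Hb); congr quo_order.
  rewrite /setsum; congr image2; apply/seteqP; split=> c [Zc Bc]; split=> //.
    apply/rat_span_torsion; move: Bc; rewrite (bounds_attach _ p_inj pU) => -[q _ eq_q].
    by exists q; rewrite /D map_mxsub.
  rewrite (bounds_attach _ p_inj pU); have [q eq_q] := (rat_span_torsion _ _).2 Bc.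
  by exists q => //; rewrite -eq_q /D map_mxsub.
split.
- exact: has_index_finite relH.
- by rewrite [relH_order _ _ _]orderH.
- rewrite [relH_order _ _ _]orderH orderX orderU orderC order'; split=> //.
  apply: has_index_gt0 Ht; apply: subgroup0; apply: subgroup_torsion_in => //.
  exact: subgroup_int_span.
Qed.

End RelativeHomology.

(** * Gram determinants and the spanning forest *)

(** Cauchy-Binet sums over all [W] of size [k]. Coforests have that size, and for any other [W] the
    minor is singular and its term vanishes. *)
Lemma gram_det_coforests (X : finCW) e k (p : 'I_k -> cells X e.+2) U :
    injective p -> p @: 'I_k = U ->
    let D := intQ (rowsub p (incidence X e.+1)) in
    row_free D ->
  \det (D *m D^T) =
  \sum_(W : {set cells X e.+1} | `[< spanning_coforest (attach (whole X) U) W >])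
     (relH_order (attach (whole X) U) (attach (whole X) (~: W)%SET) e.+1)%:R ^+ 2.
Proof.
move=> p_inj pU D freeD; rewrite det_mulmx_minors.
rewrite (bigID (fun W => `[< spanning_coforest (attach (whole X) U) W >])) /=.
rewrite [X in _ + X]big1 ?addr0 => [|W /andP[/eqP cardW /asboolPn ncof]].
  rewrite [LHS](eq_bigl (fun W => `[< spanning_coforest (attach (whole X) U) W >])) => [|W].
    by apply: eq_bigr => W /asboolP cofW; have [_ -> _] := relH_weight p_inj pU freeD cofW.
  apply: andb_idl => /asboolP /(spanning_coforestP _ p_inj pU freeD)[freeW fullW].
  by rewrite -(eqP fullW) (eqP freeW).
apply/eqP/contraT => det_neq0; case: ncof; apply/(spanning_coforestP _ p_inj pU freeD).
move: det_neq0; rewrite -/D -trmx_mxsub; move: (cols W D); clear -cardW.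
(* Eliminating [cardW] makes the submatrix square, where a nonzero determinant gives both row free
   and row full. *)
case: _ / cardW => A; rewrite det_mulmx det_tr mulf_eq0 orbb.
by rewrite row_free_unit row_full_unit unitmxE unitfE.
Qed.

(** The forest condition concerns real cycles; a rational cycle is transported to them by the
    injective map [ratr]. *)
Lemma forest_boundary_inj (R : realType) (X : finCW) d (V : {set cells X d.+1}) :
    spanning_forest R V ->
  forall c : 'rV[rat]_(ncells X d.+1),
    (forall x, x \notin V -> c 0 x = 0) -> c *m intQ (incidence X d) = 0 -> c = 0.
Proof.
case=> _ cyc0 c cV c0; have : cycles R (attach (whole X) V) d.+1 (map_mx ratr c).
  split=> [x | ]; first by rewrite attach_eq mxE => /cV ->; rewrite raddf0.
  have -> : boundary (map_mx ratr c) = map_mx (ratr : rat -> R) (c *m intQ (incidence X d)).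
    by rewrite map_mxM; congr (_ *m _); apply/matrixP=> i j; rewrite !mxE /= ratr_int.
  by rewrite c0 raddf0.
rewrite cyc0 => /= /matrixP eq_c; apply/matrixP=> i j; move: (eq_c i j).
by rewrite !mxE => /eqP; rewrite fmorph_eq0 => /eqP.
Qed.

Lemma mesh_matrixE (X : finCW) d (V : {set cells X d.+1}) :
  let D := rowsub (enum_val : 'I_#|V| -> _) (intQ (incidence X d)) in
  mesh_matrix V = D *m D^T.
Proof.
apply/matrixP=> i j; rewrite !mxE /pairing; apply: eq_bigr => x _.
by rewrite /= -!rowE !mxE.
Qed.

Theorem theorem7p2 (R : realType) (X : finCW) (d : nat) (hd : (1 <= d)%N)
    (V1 : {set cells X d.+1}) (hV1 : spanning_forest R V1) :
  let M := mesh_matrix V1 in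
  let b := bdim X d in
  (* sigma k is the coefficient of (-1)^k t^(b-k) in det (t Id - M) *)
  let sigma k : rat := (-1) ^+ k * (char_poly M)`_(b - k)%N in
  (* X_U = X^(d) \cup U, and X_{W^c} = X^(d-1) \cup (S_d \ W) *)
  let XU (U : {set cells X d.+1}) := attach (whole X) U in
  let XC (W : {set cells X d}) := attach (whole X) (~: W)%SET in
  [/\ #|V1| = b,
      exists2 lam : #|V1|.-tuple algC,
        char_poly (map_mx ratr M) = \prod_(z <- lam) ('X - z%:P)
      & forall k, (k <= b)%N -> ratr (sigma k) = elem_sym k lam,
      forall k, (k <= b)%N ->
        sigma k =
        \sum_(U : {set cells X d.+1} | (U \subset V1) && (#|U| == k))
          \sum_(W : {set cells X d} | `[< spanning_coforest (XU U) W >])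
             (relH_order (XU U) (XC W) d)%:R ^+ 2
    & forall (U : {set cells X d.+1}) (W : {set cells X d}),
        U \subset V1 -> spanning_coforest (XU U) W ->
        relH_finite (XU U) (XC W) d /\
        (relH_order (XU U) (XC W) d)%:R =
          (torsion_order (XU U) d * torsion_order (XC W) d.-1
             * tprime_order (XU U) (XC W) d)%N%:R
          / (torsion_order (whole X) d.-1)%:R :> rat].
Proof.
case: d hd V1 hV1 => // e _ V1 hV1 M b sigma XU XC.
have cardV : #|V1| = b by case: hV1.
have rows_free k (p : 'I_k -> cells X e.+2) U : injective p -> p @: 'I_k = U ->
    U \subset V1 -> row_free (intQ (rowsub p (incidence X e.+1))).
  move=> p_inj pU /fintype.subsetP UV; apply: inj_row_free => x.
  rewrite map_mxsub; apply: (rowsub_mulmx_eq0 p_inj pU) => c cU.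
  by apply: (forest_boundary_inj hV1) => j jV; apply: cU; apply: contra jV; apply: UV.
have ratrM : char_poly (map_mx ratr M) = map_poly (ratr : rat -> algC) (char_poly M).
  by rewrite map_char_poly.
split=> //.
(* The eigenvalues are the roots over [algC]; their elementary symmetric functions come from Vieta's
   formulas. *)
- have [r] := closed_field_poly_normal (char_poly (map_mx (ratr : rat -> algC) M)).
  rewrite (monicP (char_poly_monic _)) scale1r => eq_r.
  have size_r : size r == #|V1|.
    by rewrite -eqSS -(size_prod_XsubC r id) -eq_r size_char_poly.
  exists (Tuple size_r) => // k le_kb; rewrite /sigma rmorphM rmorphXn rmorphN1 /=.
  rewrite -coef_map -ratrM eq_r -cardV -ltnS in le_kb *.
  by rewrite (mpoly.mroots_coeff (Tuple size_r) (Ordinal le_kb)) signrMK.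
- move=> k; rewrite /sigma -cardV => le_kV; rewrite coef_char_poly_minors // signrMK.
  (* Index sets of principal minors correspond to the subsets of [V1] through [enum_val]. *)
  rewrite [RHS](reindex_onto (fun J : {set 'I_#|V1|} => [set enum_val i | i in J]%SET)
    (fun U => [set i | enum_val i \in U]%SET)) /=; last first.
    move=> U /andP[/fintype.subsetP UV _]; apply/setP=> x; apply/imsetP/idP => [[i] | xU].
      by rewrite inE => iU ->.
    by exists (enum_rank_in (UV x xU) x); rewrite ?inE enum_rankK_in ?UV.
  apply: eq_big => [J | J _].
    rewrite card_imset; last exact: enum_val_inj.
    have -> : [set enum_val i | i in J]%SET \subset V1.
      by apply/fintype.subsetP=> _ /imsetP[i _ ->]; apply: enum_valP.
    rewrite andTb andb_idr // => _; apply/eqP/setP=> i.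
    by rewrite inE mem_imset //; apply: enum_val_inj.
  (* With this enumeration the principal submatrix of [M] at [J] is exactly the Gram matrix of the
     boundaries of the cells [p i]. *)
  pose p (i : 'I_#|J|) : cells X e.+2 := enum_val (enum_val i).
  have p_inj : injective p by move=> i j /enum_val_inj/enum_val_inj.
  have pJ : p @: 'I_#|J| = [set enum_val i | i in J]%SET.
    by rewrite -[in RHS](enum_val_image J) -imset_comp.
  rewrite -(gram_det_coforests p_inj pJ); last first.
    apply: (rows_free _ _ _ p_inj pJ).
    by apply/fintype.subsetP=> _ /imsetP[i _ ->]; apply: enum_valP.
  rewrite /principal_submx /M mesh_matrixE mxsub_mul map_mxsub !trmx_mxsub.
  by congr (\det (_ *m _)); apply/matrixP=> i j; rewrite !mxE.
- move=> U W UV cofW; have freeU := rows_free _ _ _ enum_val_inj (enum_val_image U) UV.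
  have [fin _ [eqN t0]] := relH_weight enum_val_inj (enum_val_image U) freeU cofW.
  split=> //; apply/(canRL (mulfK _)); first by rewrite pnatr_eq0 -lt0n.
  by rewrite -natrM eqN.
Qed.
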